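(* Let $\Omega=\{1,\dots,d\}^{\mathbb N}$ with the shift $\sigma$, let $A:\Omega\to\mathbb R$ be Lipschitz continuous, let $h$ be the Peierls barrier of $A$ and $\mathcal A$ the Aubry set of $A$. Then for any $x\in\mathcal A$, $h(x,\sigma(x))+h(\sigma(x),x)=0$.
   Context: $\Omega$ carries the metric $d(x,y)=2^{-\min\{n:\ x_n\ne y_n\}}$ and $\sigma(x_0x_1x_2\ldots)=x_1x_2\ldots$. $m(A)=\max\int A\,d\nu$ over $\sigma$-invariant Borel probability measures $\nu$. $S_n(f)=f+f\circ\sigma+\dots+f\circ\sigma^{n-1}$. The Peierls barrier is $$h(x,y)=\lim_{\epsilon\to0}\ \limsup_{n\to\infty}\ \sup\{S_n(A-m(A))(z):\ z\in\Omega,\ \sigma^n(z)=y,\ d(x,z)<\epsilon\}\in[-\infty,+\infty).$$ The Mañé potential is $S_A(x,y)=\lim_{\epsilon\to0}\sup\{S_n(A-m(A))(z):\ n\ge1,\ \sigma^n(z)=y,\ d(z,x)<\epsilon\}$, and the Aubry set is $\mathcal A=\{x\in\Omega:\ S_A(x,x)=0\}$. *)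

(* Defs.v *)
From HB Require Import structures.
From mathcomp Require Import all_boot all_order all_algebra.
From mathcomp Require Import all_classical all_reals all_analysis.

Set Implicit Arguments.
Unset Strict Implicit.
Unset Printing Implicit Defensive.

Import Order.TTheory GRing.Theory Num.Theory.
Import numFieldNormedType.Exports.

Local Open Scope classical_set_scope.
Local Open Scope ring_scope.

(* One-sided sequences over an alphabet of d.+1 letters: the alphabet
   {1, ..., D} with D = d.+1 >= 1 is encoded by 'I_d.+1.  The parameter R is
   only there to carry the R-valued metric. *)
Definition Omega (R : realType) (d : nat) : Type := nat -> 'I_d.+1.

HB.instance Definition _ (R : realType) (d : nat) :=
  Choice.on (Omega R d).
HB.instance Definition _ (R : realType) (d : nat) :=
  isPointed.Build (Omega R d) (fun=> ord0).

Definition seqdist (R : realType) (d : nat) (x y : Omega R d) : R :=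
  if pselect (exists n, x n != y n) is left xy then 2 ^- ex_minn xy else 0.

Section seqdist_metric.
Context (R : realType) (d : nat).
Implicit Types x y z : Omega R d.

Let seqdist_leP x y (N : nat) :
  reflect (forall n, (n < N)%N -> x n = y n) (seqdist x y <= 2 ^- N).
Proof.
rewrite /seqdist; case: pselect => [e|ne].
  case: ex_minnP => m mxy mmin; rewrite lef_pV2 ?posrE ?exprn_gt0//.
  rewrite ler_eXn2l ?ltr1n//; apply: (iffP idP) => [Nm n nN|xy].
    apply/eqP/negPn/negP => /mmin; apply/negP; rewrite -ltnNge.
    exact: leq_trans nN Nm.
  by rewrite leqNgt; apply/negP => /xy/eqP; rewrite (negbTE mxy).
rewrite invr_ge0 exprn_ge0//; apply: ReflectT => n _.
by apply/eqP/negPn/negP => nxy; apply: ne; exists n.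
Qed.

Let seqdist_cases x y : seqdist x y = 0 \/ exists n, seqdist x y = 2 ^- n.
Proof.
by rewrite /seqdist; case: pselect => [e|_]; [right; eexists|left].
Qed.

Let seqdist_ge0 x y : 0 <= seqdist x y.
Proof.
by have [->//|[n ->]] := seqdist_cases x y; rewrite invr_ge0 exprn_ge0.
Qed.

Let seqdistxx x : seqdist x x = 0.
Proof.
by rewrite /seqdist; case: pselect => // e; exfalso; case: e => n; rewrite eqxx.
Qed.

Let seqdist_eq0 x y : seqdist x y = 0 -> x = y.
Proof.
move=> xy0; apply: funext => n.
by apply: (seqdist_leP x y n.+1 _ n) => //; rewrite xy0 invr_ge0 exprn_ge0.
Qed.

Let seqdist_sym x y : seqdist x y = seqdist y x.
Proof.
have le (u v : Omega R d) : seqdist u v <= seqdist v u.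
  have [/seqdist_eq0 ->//|[n vun]] := seqdist_cases v u.
  rewrite vun; apply/seqdist_leP => k kn; apply/esym.
  by move: k kn; apply/seqdist_leP; rewrite vun.
by apply/eqP; rewrite eq_le !le.
Qed.

Let seqdist_triangle y x z : seqdist x z <= seqdist x y + seqdist y z.
Proof.
have [/seqdist_eq0 ->|[n xy]] := seqdist_cases x y; first by rewrite seqdistxx add0r.
have [/seqdist_eq0 <-|[m yz]] := seqdist_cases y z; first by rewrite seqdistxx addr0.
have xyP := elimT (seqdist_leP x y n); rewrite xy in xyP.
have yzP := elimT (seqdist_leP y z m); rewrite yz in yzP.
apply: (@le_trans _ _ (2 ^- minn n m)).
  apply/seqdist_leP => k; rewrite leq_min => /andP[kn km].
  by rewrite xyP// yzP.
rewrite xy yz; have [_|_] := leqP n m.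
  by rewrite lerDl invr_ge0 exprn_ge0.
by rewrite lerDr invr_ge0 exprn_ge0.
Qed.

HB.instance Definition _ := @isMetric.Build R (Omega R d) (@seqdist R d)
  seqdistxx seqdist_eq0 seqdist_sym seqdist_triangle.

End seqdist_metric.

Definition shift_map (R : realType) (d : nat) (x : Omega R d) : Omega R d :=
  fun n => x n.+1.

Definition lipschitz_continuous (R : realType) (d : nat) (A : Omega R d -> R) :=
  exists L : R, forall x y, `|A x - A y| <= L * mdist x y.

Definition BorelOmega (R : realType) (d : nat) :=
  g_sigma_algebraType (@open (Omega R d)).

Definition shift_invariant (R : realType) (d : nat)
    (nu : probability (BorelOmega R d) R) :=
  forall B : set (BorelOmega R d), measurable B ->
    nu (@shift_map R d @^-1` B) = nu B.

(* For Lipschitz continuous A the set below is nonempty and bounded, and its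
   supremum is attained (weak-* compactness), so this is the maximum. *)
Definition max_mean (R : realType) (d : nat) (A : Omega R d -> R) : R :=
  sup [set Rintegral nu setT A |
        nu in [set nu : probability (BorelOmega R d) R | shift_invariant nu]].

Definition birkhoff_sum (R : realType) (d : nat) (f : Omega R d -> R) (n : nat)
    (x : Omega R d) : R :=
  \sum_(k < n) f (iter k (@shift_map R d) x).

(* Suprema are taken in \bar R, so that the supremum of the empty set is -oo. *)
Definition peierls_barrier (R : realType) (d : nat) (A : Omega R d -> R)
    (x y : Omega R d) : \bar R :=
  lim ((fun eps : R => limn_esup (fun n : nat =>
         ereal_sup [set (birkhoff_sum (fun w => A w - max_mean A) n z)%:E |
           z in [set z | iter n (@shift_map R d) z = y /\ mdist x z < eps]]))
       @ 0^'+).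

Definition mane_potential (R : realType) (d : nat) (A : Omega R d -> R)
    (x y : Omega R d) : \bar R :=
  lim ((fun eps : R =>
         ereal_sup [set (birkhoff_sum (fun w => A w - max_mean A) nz.1 nz.2)%:E |
           nz in [set nz : nat * Omega R d | [/\ (1 <= nz.1)%N,
             iter nz.1 (@shift_map R d) nz.2 = y & mdist nz.2 x < eps]]])
       @ 0^'+).

Definition aubry_set (R : realType) (d : nat) (A : Omega R d -> R) :
    set (Omega R d) :=
  [set x | mane_potential A x x = 0%E].

(* Main.v *)
Require Import Defs.
From mathcomp Require Import all_boot all_order all_algebra.
From mathcomp Require Import all_classical all_reals all_analysis.
From mathcomp Require Import lra.

Set Implicit Arguments.
Unset Strict Implicit.
Unset Printing Implicit Defensive.

Import Order.TTheory GRing.Theory Num.Theory.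
Import numFieldNormedType.Exports.

Local Open Scope classical_set_scope.
Local Open Scope ring_scope.

(** Write [B = A - m(A)].  Two orbit segments, one ending at [y] and the other
    starting close to [y], can be glued by concatenating words; since [A] is
    Lipschitz and [d] contracts geometrically along inverse branches, this
    changes the Birkhoff sum by an arbitrarily small amount, independent of the
    lengths.  If [x] is in the Aubry set, gluing almost-optimal loops at [x]
    yields loops of arbitrarily large length with Birkhoff sum close to [0].
    Prolonging such a loop by one step gives [h(x, sigma x) >= B x], and removing
    its first step gives [h(sigma x, x) >= - B x].  Conversely, gluing a segment
    from [x] to [sigma x] with one from [sigma x] to [x] gives a loop at [x],
    whose Birkhoff sum is at most [S_A(x, x) = 0] up to a small error; hence
    [h(x, sigma x) + h(sigma x, x) <= 0]. *)

(** * Limits at zero from the right and dyadic precision *)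

Lemma lim_at_right0_nondecreasing (R : realType) (f : R -> \bar R) :
  (forall a b, 0 < a -> a <= b -> (f a <= f b)%E) ->
  lim (f @ 0^'+) = ereal_inf [set f e | e in [set e | 0 < e]].
Proof.
move=> fnd.
have -> : [set e : R | 0 < e] = [set` `]0, +oo[%R].
  by apply/seteqP; split => e /=; rewrite in_itv/= andbT.
apply: cvg_lim => //; apply: nondecreasing_at_right_cvge => // a b.
by rewrite !in_itv/= !andbT => a0 _ ab; exact: fnd.
Qed.

Lemma ex_invexp2_lt (R : realType) (L e : R) (K : nat) : 0 <= L -> 0 < e ->
  exists N, [/\ (K <= N)%N, 2 ^- N < e & L * 2 ^- N < e].
Proof.
move=> L0 e0; have L1 : 0 < L + 1 by lra.
pose N := maxn K (Num.bound ((L + 1) / e)).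
have LN : (L + 1) / e < 2 ^+ N by apply: upper_nthrootP; exact: leq_maxr.
exists N.
have N0 : 0 < 2 ^- N :> R by rewrite invr_gt0 exprn_gt0.
have : (L + 1) * 2 ^- N < e.
  by rewrite ltr_pdivrMr ?exprn_gt0// mulrC -ltr_pdivrMr.
rewrite mulrDl mul1r => LNe.
have : 0 <= L * 2 ^- N by rewrite mulr_ge0// ltW.
by split; [exact: leq_maxl|lra..].
Qed.

(** * Agreement of prefixes and gluing of orbit segments *)

Section shift_space.
Context (R : realType) (d : nat).
Implicit Types (x y z u v w : Omega R d) (f : Omega R d -> R).
Local Notation sigma := (@shift_map R d).

Definition agree (N : nat) x y := forall k, (k < N)%N -> x k = y k.

Lemma agree_le (M N : nat) x y : (M <= N)%N -> agree N x y -> agree M x y.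
Proof. by move=> MN xy k kM; apply: xy; exact: leq_trans MN. Qed.

Lemma agree_sym (N : nat) x y : agree N x y -> agree N y x.
Proof. by move=> xy k /xy. Qed.

Lemma agree_trans (N : nat) y x z : agree N x y -> agree N y z -> agree N x z.
Proof. by move=> xy yz k kN; rewrite xy// yz. Qed.

Lemma mdist_leP (N : nat) x y : mdist x y <= 2 ^- N <-> agree N x y.
Proof.
rewrite /mdist/= /seqdist; case: pselect => [e|ne]; last first.
  split => [_ n _|_]; last by rewrite invr_ge0 exprn_ge0.
  by apply/eqP/negPn/negP => nxy; apply: ne; exists n.
case: ex_minnP => m mxy mmin; rewrite lef_pV2 ?posrE ?exprn_gt0//.
rewrite ler_eXn2l ?ltr1n//; split=> [Nm n nN|xy].
  apply/eqP/negPn/negP => /mmin; apply/negP; rewrite -ltnNge.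
  exact: leq_trans nN Nm.
by rewrite leqNgt; apply/negP => /xy/eqP; rewrite (negbTE mxy).
Qed.

Lemma iter_shiftE (n k : nat) x : iter n sigma x k = x (n + k)%N.
Proof. by elim: n k => [|n IH] k //=; rewrite /shift_map IH addnS. Qed.

Lemma birkhoff_sumD f (m n : nat) z : birkhoff_sum f (m + n) z =
  birkhoff_sum f m z + birkhoff_sum f n (iter m sigma z).
Proof.
rewrite /birkhoff_sum big_split_ord/=; congr (_ + _).
by apply: eq_bigr => k _; rewrite addnC iterD.
Qed.

Lemma birkhoff_sum1 f z : birkhoff_sum f 1 z = f z.
Proof. by rewrite /birkhoff_sum big_ord1. Qed.

Definition lipschitz_with (L : R) f :=
  0 <= L /\ forall u v, `|f u - f v| <= L * mdist u v.

Lemma lipschitz_agree (L : R) f (N : nat) u v : lipschitz_with L f ->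
  agree N u v -> `|f u - f v| <= L * 2 ^- N.
Proof.
move=> [L0 fL] /mdist_leP uv; apply: le_trans (fL u v) _.
exact: ler_wpM2l.
Qed.

(* The factor [1 - 2 ^- n] makes the bound provable by induction on [n]. *)
Lemma birkhoff_sum_distortion (L : R) f (N n : nat) u v :
  lipschitz_with L f -> agree (n + N) u v ->
  `|birkhoff_sum f n u - birkhoff_sum f n v| <= L * 2 ^- N * (1 - 2 ^- n).
Proof.
move=> fL; elim: n u v => [|n IH] u v uv.
  by rewrite /birkhoff_sum !big_ord0 subrr normr0 expr0 invr1 subrr mulr0.
rewrite -add1n !birkhoff_sumD !birkhoff_sum1 opprD addrACA.
apply: le_trans (ler_normD _ _) _.
have /IH le2 : agree (n + N) (iter 1 sigma u) (iter 1 sigma v).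
  by move=> k kn; rewrite !iter_shiftE uv.
have := lipschitz_agree fL uv; rewrite exprD invfM mulrCA mulrC => le1.
apply: le_trans (lerD le1 le2) _.
rewrite -mulrDr ler_wpM2l//; last by rewrite exprS invfM; lra.
by case: fL => L0 _; rewrite mulr_ge0// invr_ge0 exprn_ge0.
Qed.

(** The witness follows [u] for [m] letters and then [v]. Its [m]-th shift is exactly [v], so only
    the first [m] summands carry an error. *)
Lemma glue_segments (L : R) f (m n N : nat) u v : lipschitz_with L f ->
  agree N (iter m sigma u) v ->
  exists w, [/\ iter (m + n) sigma w = iter n sigma v, agree (m + N) w u &
    birkhoff_sum f m u + birkhoff_sum f n v - L * 2 ^- N <=
    birkhoff_sum f (m + n) w].
Proof.
move=> fL uv.
pose w : Omega R d := fun k => if (k < m)%N then u k else v (k - m)%N.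
have wv : iter m sigma w = v.
  by apply: funext => k; rewrite iter_shiftE /w ltnNge leq_addr/= addKn.
have wu : agree (m + N) w u.
  move=> k kmN; rewrite /w; have [//|mk] := ltnP k m.
  by rewrite -uv ?ltn_subLR// iter_shiftE subnKC.
exists w; split => //; first by rewrite addnC iterD wv.
rewrite birkhoff_sumD wv.
have := birkhoff_sum_distortion fL wu.
have N0 : 0 <= L * 2 ^- N.
  by case: fL => L0 _; rewrite mulr_ge0// invr_ge0 exprn_ge0.
have m0 : 0 <= L * 2 ^- N * 2 ^- m by rewrite mulr_ge0// invr_ge0 exprn_ge0.
rewrite mulrBr mulr1 ler_norml => /andP[+ _]; lra.
Qed.

(** For [f = A - m(A)] this is the inequality [S_A(x, x) >= 0], freed of limits and suprema. *)
Definition loops (x : Omega R d) f := forall (N : nat) (e : R), 0 < e ->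
  exists n z, [/\ (1 <= n)%N, iter n sigma z = x, agree N z x &
    - e < birkhoff_sum f n z].

(** Each further loop glued on has length at least 1, so induction on [K] reaches any length. *)
Lemma long_loops (L : R) f x : lipschitz_with L f -> loops x f ->
  forall (K N : nat) (e : R), 0 < e ->
  exists n z, [/\ (K <= n)%N, iter n sigma z = x, agree N z x &
    - e < birkhoff_sum f n z].
Proof.
move=> fL lx; elim=> [|K IH] N e e0.
  by have [n [z [_ ? ? ?]]] := lx N _ e0; exists n, z.
(* Half of [e] goes to the loop from the induction hypothesis, a quarter to the new loop and a
   quarter to the gluing error. *)
have e2 : 0 < e / 2 by lra.
have e4 : 0 < e / 4 by lra.
have [m [u [Km ux uN fu]]] := IH N _ e2.
have [M [NM _ LM]] := ex_invexp2_lt N (proj1 fL) e4.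
have [n [v [n1 vx vM fv]]] := lx M _ e4.
have uv : agree M (iter m sigma u) v by rewrite ux; exact: agree_sym.
have [w [wx wu fw]] := glue_segments n fL uv.
exists (m + n)%N, w; split.
- by rewrite -addn1 leq_add.
- by rewrite wx.
- by apply: agree_trans uN; apply: agree_le wu; rewrite (leq_trans NM) ?leq_addl.
- by lra.
Qed.

(** * Bounds for the Mañé potential and the Peierls barrier *)

Section barriers.
Variable A : Omega R d -> R.
Let B := fun w => A w - max_mean A.

(** A larger [eps] admits more segments, so the limit at zero is an infimum. *)
Lemma mane_potentialE x y : mane_potential A x y =
  ereal_inf [set ereal_sup [set (birkhoff_sum B nz.1 nz.2)%:E |
    nz in [set nz : nat * Omega R d | [/\ (1 <= nz.1)%N,
      iter nz.1 sigma nz.2 = y & mdist nz.2 x < eps]]] |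
    eps in [set eps | 0 < eps]].
Proof.
apply: lim_at_right0_nondecreasing => a b _ ab.
apply: ge_ereal_sup => _ [[n z]/= [n1 zy zx]] <-.
apply: ereal_sup_ubound; exists (n, z) => //=; split => //.
exact: lt_le_trans ab.
Qed.

Lemma peierls_barrierE x y : peierls_barrier A x y =
  ereal_inf [set limn_esup (fun n => ereal_sup [set (birkhoff_sum B n z)%:E |
      z in [set z | iter n sigma z = y /\ mdist x z < eps]]) |
    eps in [set eps | 0 < eps]].
Proof.
apply: lim_at_right0_nondecreasing => a b _ ab.
(* [limn_esup] is itself an infimum, over neighbourhoods [V] of infinity, of suprema over [V]. *)
apply: le_ereal_inf_tmp => _ [V Voo] <-; apply: ge_ereal_inf.
eexists; first by exists V.
apply: ge_ereal_sup => _ [n Vn] <-; apply: le_ereal_sup_tmp.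
eexists; first by exists n.
apply: ge_ereal_sup => _ [z [zy zx]] <-.
apply: ereal_sup_ubound; exists z => //; split => //.
exact: lt_le_trans ab.
Qed.

Lemma aubry_loops x : aubry_set A x -> loops x B.
Proof.
rewrite /aubry_set/= mane_potentialE => S0 N e e0.
have N0 : 0 < 2 ^- N :> R by rewrite invr_gt0 exprn_gt0.
have : ((- e)%:E < ereal_sup [set (birkhoff_sum B nz.1 nz.2)%:E |
    nz in [set nz : nat * Omega R d | [/\ (1 <= nz.1)%N,
      iter nz.1 sigma nz.2 = x & (mdist nz.2 x < 2 ^- N)%R]]])%E.
  apply: (@lt_le_trans _ _ 0%E); first by rewrite lte_fin oppr_lt0.
  by rewrite -S0; apply: ereal_inf_lbound; exists (2 ^- N).
move=> /ereal_sup_gt[_ [[n z]/= [n1 zx zN]] <-]; rewrite lte_fin => Bz.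
by exists n, z; split => //; apply/mdist_leP/ltW.
Qed.

Lemma aubry_loops_le x : aubry_set A x -> forall e : R, 0 < e ->
  exists N : nat, forall (n : nat) z, (1 <= n)%N -> iter n sigma z = x ->
    agree N z x -> birkhoff_sum B n z <= e.
Proof.
rewrite /aubry_set/= mane_potentialE => S0 e e0.
have : (0 < e%:E)%E by rewrite lte_fin.
rewrite -{1}S0 => /ereal_inf_lt[_ [eps /= eps0 <-]] /ltW/ereal_supP supe.
have [N [_ Neps _]] := ex_invexp2_lt 0 (lexx 0) eps0.
exists N => n z n1 zx /mdist_leP zN; rewrite -lee_fin; apply: supe.
by exists (n, z) => //=; split => //; exact: le_lt_trans Neps.
Qed.

Lemma peierls_barrier_ge x y (c : R) :
  (forall (K N : nat) (e : R), 0 < e -> exists n z, [/\ (K <= n)%N,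
    iter n sigma z = y, agree N z x & c - e <= birkhoff_sum B n z]) ->
  (c%:E <= peierls_barrier A x y)%E.
Proof.
move=> cxy; rewrite peierls_barrierE.
apply: le_ereal_inf_tmp => _ [eps /= eps0 <-].
apply: le_ereal_inf_tmp => _ [V [K _ KV] <-].
apply/lee_addgt0Pr => e e0.
have [N [_ Neps _]] := ex_invexp2_lt 0 (lexx 0) eps0.
have [n [z [Kn zy /agree_sym/mdist_leP zx cz]]] := cxy K N e e0.
rewrite -leeBlDr// -EFinB; apply: le_ereal_sup_tmp.
eexists; first by exists n => //; exact: KV.
apply: le_ereal_sup_tmp; exists (birkhoff_sum B n z)%:E => //.
by exists z => //; split => //; exact: le_lt_trans Neps.
Qed.

(** Barrier and limsup are both infima, so one radius and the lengths from 1 on suffice. An extended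
    [c] allows [-oo], the supremum when no segment exists. *)
Lemma peierls_barrier_le x y (c : \bar R) (N : nat) :
  (forall (n : nat) z, (1 <= n)%N -> iter n sigma z = y -> agree N z x ->
    ((birkhoff_sum B n z)%:E <= c)%E) ->
  (peierls_barrier A x y <= c)%E.
Proof.
move=> cxy; rewrite peierls_barrierE; apply: ge_ereal_inf.
eexists; first by exists (2 ^- N); rewrite //= invr_gt0 exprn_gt0.
apply: ge_ereal_inf; eexists; first by exists [set n | (1 <= n)%N] => //; exists 1%N.
apply: ge_ereal_sup => _ [n /= n1 <-]; apply: ge_ereal_sup => _ [z [zy xz] <-].
by apply: cxy => //; apply/agree_sym/mdist_leP/ltW.
Qed.

Variables (L : R) (x : Omega R d).
Hypotheses (BL : lipschitz_with L B) (Ax : aubry_set A x).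

Lemma peierls_barrier_shift_ge : ((B x)%:E <= peierls_barrier A x (sigma x))%E.
Proof.
apply: peierls_barrier_ge => K N e e0.
have [n [z [Kn zx zN Bz]]] := long_loops BL (aubry_loops Ax) K N e0.
exists (n + 1)%N, z; split => //; first by rewrite (leq_trans Kn) ?leq_addr.
  by rewrite addn1/= zx.
by rewrite birkhoff_sumD zx birkhoff_sum1; lra.
Qed.

Lemma peierls_barrier_shift_back_ge :
  ((- B x)%:E <= peierls_barrier A (sigma x) x)%E.
Proof.
apply: peierls_barrier_ge => K N e e0; have e2 : 0 < e / 2 by lra.
(* Dropping the first step costs one letter of agreement and one unit of length, hence [N.+1] and
   [K.+1]. The other [e / 2] pays for replacing [B z] by [B x]. *)
have [M [NM _ LM]] := ex_invexp2_lt N.+1 (proj1 BL) e2.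
have [n' [z [+ + zM +]]] := long_loops BL (aubry_loops Ax) K.+1 M e2.
case: n' => [//|n] Kn zx; rewrite -(add1n n) birkhoff_sumD birkhoff_sum1 => Bz.
exists n, (sigma z); split => //; first by rewrite -iterSr.
  by move=> k kN; rewrite /shift_map zM// (leq_trans _ NM).
move: Bz => /=; have := lipschitz_agree BL zM.
by rewrite ler_norml => /andP[_]; lra.
Qed.

(** The bound concerns individual segments, so that suprema over [u] and [v] can be taken one after
    the other. *)
Lemma glued_sum_le (e : R) : 0 < e -> exists N : nat, forall (m n : nat) u v,
  (1 <= m)%N -> (1 <= n)%N -> iter m sigma u = sigma x -> iter n sigma v = x ->
  agree N u x -> agree N v (sigma x) ->
  birkhoff_sum B m u + birkhoff_sum B n v <= e.
Proof.
move=> e0; have e2 : 0 < e / 2 by lra.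
have [M xM] := aubry_loops_le Ax e2.
have [N [MN _ LN]] := ex_invexp2_lt M (proj1 BL) e2.
exists N => m n u v m1 n1 ux vx uN vN.
have uv : agree N (iter m sigma u) v by rewrite ux; exact: agree_sym.
have [w [wx wu Bw]] := glue_segments n BL uv.
have /xM : (1 <= m + n)%N by rewrite (leq_trans m1) ?leq_addr.
move=> /(_ w); rewrite wx => /(_ vx).
suff wM : agree M w x by move=> /(_ wM); lra.
apply: (agree_le MN); apply: agree_trans uN.
by apply: agree_le wu; exact: leq_addl.
Qed.

End barriers.
End shift_space.

Theorem lemma4p3 (R : realType) (d : nat) (A : Omega R d -> R)
    (hA : lipschitz_continuous A) (x : Omega R d) (hx : aubry_set A x) :
  (peierls_barrier A x (shift_map x) + peierls_barrier A (shift_map x) x = 0)%E.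
Proof.
pose B := fun w => A w - max_mean A.
have [L BL] : exists L, lipschitz_with L B.
  have [L AL] := hA; exists `|L|; split => // u v.
  rewrite /B opprD addrACA subrr addr0; apply: le_trans (AL u v) _.
  by rewrite ler_wpM2r ?ler_norm// mdist_ge0.
have h1 := peierls_barrier_shift_ge BL hx.
have h2 := peierls_barrier_shift_back_ge BL hx.
apply/eqP; rewrite eq_le; apply/andP; split; last first.
  by have := leeD h1 h2; rewrite -EFinD subrr.
apply/lee_addgt0Pr => e e0; rewrite add0e.
have [N sum_le] := glued_sum_le BL hx e0.
(* With [v] fixed, the bound is uniform in [u] and passes to the first barrier. *)
have h1_le (n : nat) v : (1 <= n)%N -> iter n (@shift_map R d) v = x ->
    agree N v (shift_map x) ->
    (peierls_barrier A x (shift_map x) <= (e - birkhoff_sum B n v)%:E)%E.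
  move=> n1 vx vN; apply: (@peierls_barrier_le _ _ _ _ _ _ N) => m u m1 ux uN.
  by rewrite lee_fin lerBrDr; exact: sum_le.
(* Finiteness licenses the subtraction below. Were the first barrier [+oo], [h1_le] would rule out
   every [v], forcing the second one to [-oo] against [h2]. *)
have h1_fin : peierls_barrier A x (shift_map x) \is a fin_num.
  rewrite fin_real// (lt_le_trans (ltNyr _) h1)/= ltNge; apply/negP => h1y.
  have : (peierls_barrier A (shift_map x) x <= -oo)%E.
    apply: (@peierls_barrier_le _ _ _ _ _ _ N) => n v n1 vx vN.
    by have := le_trans h1y (h1_le n v n1 vx vN).
  by move=> /(le_trans h2).
rewrite addeC -leeBrDr//.
apply: (@peierls_barrier_le _ _ _ _ _ _ N) => n v n1 vx vN.
rewrite leeBrDr// addeC -leeBrDr// -EFinB.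
exact: h1_le.
Qed.
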